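(* Let $A\in\mathbb{R}^{m\times n}$. Let $\mathbf{x}_1,\ldots,\mathbf{x}_k\in\mathbb{R}^m$ be an orthonormal system in $\mathbb{R}^m$ and let $\mathbf{w}_1,\ldots,\mathbf{w}_l\in\mathbb{R}^m$ be a given set of vectors. Perform the modified Gram-Schmidt algorithm on $\mathbf{x}_1,\ldots,\mathbf{x}_k,\mathbf{w}_1,\ldots,\mathbf{w}_l$ to obtain an orthonormal set $\mathbf{x}_1,\ldots,\mathbf{x}_p\in\mathbb{R}^m$, where $k\le p\le k+l$ (the first $k$ vectors being the given $\mathbf{x}_1,\ldots,\mathbf{x}_k$). Assume that $k<p$, i.e. $\mathrm{span}(\mathbf{w}_1,\ldots,\mathbf{w}_l)\nsubseteq \mathrm{span}(\mathbf{x}_1,\ldots,\mathbf{x}_k)$. Form the $p\times p$ real symmetric matrix $$S:=\big((A^{\mathrm T}\mathbf{x}_i)^{\mathrm T}(A^{\mathrm T}\mathbf{x}_j)\big)_{i,j=1}^p,$$ and let $\lambda_1\ge\ldots\ge\lambda_k$ be the $k$ largest eigenvalues of $S$ (counted with multiplicity), with corresponding orthonormal eigenvectors $\mathbf{o}_1,\ldots,\mathbf{o}_k\in\mathbb{R}^p$, so that $S\mathbf{o}_i=\lambda_i\mathbf{o}_i$ for $i=1,\ldots,k$. Let $O:=(\mathbf{o}_1,\ldots,\mathbf{o}_k)\in\mathbb{R}^{p\times k}$ be the matrix with these columns, and define the $k$ orthonormal vectors $\tilde{\mathbf{x}}_1,\ldots,\tilde{\mathbf{x}}_k\in\mathbb{R}^m$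 by $$(\tilde{\mathbf{x}}_1,\ldots,\tilde{\mathbf{x}}_k)=(\mathbf{x}_1,\ldots,\mathbf{x}_p)\,O.$$ Then $$\sum_{i=1}^k (A^{\mathrm T}\mathbf{x}_i)^{\mathrm T}(A^{\mathrm T}\mathbf{x}_i)\le\sum_{i=1}^k (A^{\mathrm T}\tilde{\mathbf{x}}_i)^{\mathrm T}(A^{\mathrm T}\tilde{\mathbf{x}}_i).$$ Furthermore, $$\lambda_i=(A^{\mathrm T}\tilde{\mathbf{x}}_i)^{\mathrm T}(A^{\mathrm T}\tilde{\mathbf{x}}_i),\qquad i=1,\ldots,k.$$
   Context: All vectors are real column vectors; $(\mathbf{a}_1,\ldots,\mathbf{a}_q)$ denotes the matrix with columns $\mathbf{a}_1,\ldots,\mathbf{a}_q$, and $^{\mathrm T}$ denotes transpose. The (modified) Gram-Schmidt algorithm, in exact arithmetic, processes the vectors in the given order, subtracts from each its orthogonal projection onto the span of the previously obtained orthonormal vectors, discards it if the result is zero, and otherwise normalizes it. Applied to $\mathbf{x}_1,\ldots,\mathbf{x}_k,\mathbf{w}_1,\ldots,\mathbf{w}_l$ with $\mathbf{x}_1,\ldots,\mathbf{x}_k$ already orthonormal, it leaves $\mathbf{x}_1,\ldots,\mathbf{x}_k$ unchanged and produces an orthonormal basis $\mathbf{x}_1,\ldots,\mathbf{x}_k,\mathbf{x}_{k+1},\ldots,\mathbf{x}_p$ of $\mathrm{span}(\mathbf{x}_1,\ldots,\mathbf{x}_k,\mathbf{w}_1,\ldots,\mathbf{w}_l)$. *)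

(* Defs.v *)
From mathcomp Require Import all_boot all_order all_algebra.
Set Implicit Arguments.
Unset Strict Implicit.
Unset Printing Implicit Defensive.
Import Order.TTheory GRing.Theory Num.Theory.
Local Open Scope ring_scope.

Definition dotv (R : rcfType) (m : nat) (u v : 'cV[R]_m) : R :=
  (u^T *m v) 0 0.

Definition orthonormal_system (R : rcfType) (m q : nat) (s : q.-tuple 'cV[R]_m) : Prop :=
  forall i j : 'I_q, dotv (tnth s i) (tnth s j) = (i == j)%:R.

Definition cols_mx (R : rcfType) (m q : nat) (s : q.-tuple 'cV[R]_m) : 'M[R]_(m, q) :=
  \matrix_(i, j) tnth s j i 0.

(* The subtracted sum is the orthogonal projection of v onto the span of q,
   because the accumulated list q is always orthonormal. The modified variant
   of the algorithm, which subtracts the terms one after the other, has the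
   same result in exact arithmetic. *)
Definition gs_residual (R : rcfType) (m : nat) (q : seq 'cV[R]_m)
    (v : 'cV[R]_m) : 'cV[R]_m :=
  v - \sum_(u <- q) dotv u v *: u.

Definition gs_step (R : rcfType) (m : nat) (q : seq 'cV[R]_m)
    (v : 'cV[R]_m) : seq 'cV[R]_m :=
  let r := gs_residual q v in
  if r == 0 then q else rcons q ((Num.sqrt (dotv r r))^-1 *: r).

Definition gram_schmidt (R : rcfType) (m : nat) (s : seq 'cV[R]_m) :
    seq 'cV[R]_m :=
  foldl (@gs_step R m) [::] s.

(* Multiplicities are those of the roots of the characteristic polynomial:
   [mu] lists the remaining p - k eigenvalues. *)
Definition largest_eigenvalues (R : rcfType) (p k : nat) (S : 'M[R]_p)
    (lam : k.-tuple R) : Prop :=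
  exists mu : seq R,
    char_poly S = \prod_(z <- lam ++ mu) ('X - z%:P) /\
    sorted >=%R (lam ++ mu).

(* Main.v *)
Require Import Defs.
From HB Require Import structures.
From mathcomp Require Import all_boot all_order all_algebra.
From mathcomp Require Import reals.
From mathcomp Require Import complex.
Set Implicit Arguments.
Unset Strict Implicit.
Unset Printing Implicit Defensive.
Import Order.TTheory GRing.Theory Num.Theory.
Local Open Scope ring_scope.

(** Write X, Y, O, Xt for the matrices whose columns are the x_i, y_i, o_i and
the new vectors, so that Xt = Y O and S = (A^T Y)^T (A^T Y).

Orthonormality of the new vectors is Xt^T Xt = O^T (Y^T Y) O = O^T O = 1, and
(A^T Xt)^T (A^T Xt) = O^T S O is the diagonal matrix of the lambda_i, which
gives the equalities. Hence the right-hand side of the inequality is the sum of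
the k largest eigenvalues of S.

Gram-Schmidt leaves an orthonormal list untouched and afterwards only appends
vectors, so every x_i occurs among the y_j and X = Y V^T with V = X^T Y
([orthonormal_projection_fixed]). Then V V^T = X^T X = 1, and the left-hand side
is the trace of V S V^T. What remains is Ky Fan's inequality
([ky_fan_trace_le]): compressing a symmetric matrix to a k-dimensional subspace
gives a trace of at most the sum of its k largest eigenvalues.

Ky Fan's inequality follows from a diagonalization of S. In an orthonormal
eigenbasis the trace becomes a sum of d_j c_j, where the d_j are the eigenvalues
and c_j is the squared length of the projection of the j-th eigenvector onto the
subspace; so 0 <= c_j <= 1 and the c_j sum to k
([symmetric_spectral_weights]). Such a sum is largest when the weights 1 sit on
the k largest d_j ([weighted_sum_le_top]). The diagonalization is carried out
over the complex numbers, where it holds for all normal matrices; the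
eigenvalues are real because they are the roots of the characteristic
polynomial, whose factorization over R is a hypothesis. *)

(** * Weighted sums of a sorted list *)

Section Weights.
Variable R : realDomainType.
Implicit Types lam mu : seq R.

Lemma sorted_cat_threshold lam mu : sorted >=%R (lam ++ mu) ->
  exists t, all (>= t) lam /\ all (<= t) mu.
Proof.
have geT : transitive (>=%R : rel R) by move=> x y z /[swap]; apply: le_trans.
case/lastP: lam => [|lam t] /=.
  (* With [lam] empty, the largest element of [mu] serves as the threshold. *)
  case: mu => [|t mu] /=; first by exists 0.
  rewrite path_sortedE // => /andP[tmu _].
  by exists t; rewrite lexx.
rewrite sorted_pairwise // pairwise_cat => /and3P[/allrelP lamt_mu].
rewrite pairwise_rcons => /andP[lamt _] _.
exists t; rewrite all_rcons lexx; split=> //; apply/allP => z zmu.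
by apply: lamt_mu => //; rewrite mem_rcons mem_head.
Qed.

(** Subtract from every d_j a threshold t that separates [lam] from [mu]. Since
the c_j sum to the length of [lam], this shifts both sides equally. Then
(d_j - t) c_j <= max (d_j - t) 0, and the sum of these maxima depends on the d_j
only as a multiset: it can be taken over [lam ++ mu], where it is the sum of
z - t over [lam]. *)
Lemma weighted_sum_le_top (I : finType) (d c : I -> R) lam mu :
  sorted >=%R (lam ++ mu) -> perm_eq [seq d j | j : I] (lam ++ mu) ->
  (forall j, 0 <= c j <= 1) -> \sum_j c j = (size lam)%:R ->
  \sum_j d j * c j <= \sum_(z <- lam) z.
Proof.
move=> /sorted_cat_threshold[t [/allP lamt /allP mut]] dP c01 cS.
have -> : \sum_(z <- lam) z
    = t * (size lam)%:R + \sum_(z <- lam ++ mu) Num.max (z - t) 0.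
  rewrite big_cat /= [X in _ + (_ + X)]big1_seq => [|z /= zmu]; last first.
    by apply/max_idPr; rewrite subr_le0; apply: mut.
  rewrite addr0 [X in _ = _ + X](eq_big_seq (fun z => z - t)) => [|z zlam];
    last first.
    by apply/max_idPl; rewrite subr_ge0; apply: lamt.
  by rewrite sumrB big_const_seq count_predT iter_addr_0 mulr_natr addrC subrK.
rewrite -(perm_big _ dP) big_image /= -cS mulr_sumr -big_split /=.
apply: ler_sum => j _; have /andP[c0 c1] := c01 j.
rewrite -lerBlDl -mulrBl.
apply: (@le_trans _ _ (Num.max (d j - t) 0 * c j)).
  by rewrite ler_wpM2r // le_max lexx.
by rewrite ler_piMr // le_max lexx orbT.
Qed.
End Weights.

(** * Ky Fan's trace inequality *)

Lemma char_poly_similar (F : comUnitRingType) n (P M : 'M[F]_n) :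
  P \in unitmx -> char_poly (invmx P *m M *m P) = char_poly M.
Proof.
move=> uP; rewrite /char_poly.
have PP : map_mx polyC (invmx P) *m map_mx polyC P = 1%:M.
  by rewrite -map_mxM mulVmx // map_mx1.
have -> : char_poly_mx (invmx P *m M *m P)
   = map_mx polyC (invmx P) *m char_poly_mx M *m map_mx polyC P.
  rewrite /char_poly_mx !map_mxM /= mulmxBr mulmxBl scalar_mxC.
  by rewrite -[_%:M *m _ *m _]mulmxA PP mulmx1.
by rewrite !det_mulmx mulrAC -det_mulmx PP det1 mul1r.
Qed.

Section ComplexDiagonalization.
Local Open Scope complex_scope.
Local Open Scope sesquilinear_scope.

(** With P unitary and P S P^* diagonal, put W = V P^*. Then W W^* = 1, so
Q = W^* W is an orthogonal projection of trace k, and c_j is its j-th diagonal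
entry. It lies between 0 and 1 because Q_jj is the squared norm of row j of Q,
hence at least Q_jj ^ 2. The rows of V span the subspace to which S is
compressed; the trace is that of diag(d) Q. *)
Lemma symmetric_spectral_weights (R : rcfType) p k (S : 'M[R]_p)
    (V : 'M[R]_(k, p)) (nu : seq R) :
  S^T = S -> V *m V^T = 1%:M ->
  char_poly S = \prod_(z <- nu) ('X - z%:P) ->
  exists d c : 'I_p -> R,
    [/\ perm_eq [seq d j | j : 'I_p] nu,
        forall j, 0 <= c j <= 1,
        \sum_j c j = k%:R
      & \tr (V *m S *m V^T) = \sum_j d j * c j].
Proof.
move=> symS orthV charS.
pose f : {rmorphism R -> R[i]} := real_complex R.
have realf m n (M : 'M[R]_(m, n)) : (map_mx f M)^t* = map_mx f M^T.
  by apply/matrixP => i j; rewrite !mxE; apply/CrealP/complex_realP; eexists.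
have nS : map_mx f S \is normalmx.
  by apply/normalmxP; rewrite realf symS.
have /orthomx_spectralP := nS.
set P := spectralmx _; set D := spectral_diag _ => SE.
have uP : P \is unitarymx := spectral_unitarymx _.
have UP := unitarymx_unit uP.
have DE : perm_eq [seq D 0 j | j : 'I_p] [seq f z | z <- nu].
  apply: prod_XsubC_eq; rewrite big_image /= big_map.
  have -> : \prod_(j < p) ('X - (D 0 j)%:P) = char_poly (diag_mx D).
    rewrite char_poly_trig ?diag_mx_is_trig //.
    by apply: eq_bigr => j _; rewrite mxE eqxx.
  rewrite -(char_poly_similar (diag_mx D) UP) -SE -map_char_poly charS.
  rewrite rmorph_prod; apply: eq_bigr => z _.
  by rewrite rmorphB /= map_polyX map_polyC.
have [W WE] : exists W, W = map_mx f V *m P^t* by eexists.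
have WW : W *m W^t* = 1%:M.
  rewrite WE trmx_mul map_mxM trmxCK mulmxA mulmxKtV //.
  by rewrite realf -map_mxM orthV map_mx1.
have [Q QE] : exists Q, Q = W^t* *m W by eexists.
have QQ : Q *m Q = Q by rewrite QE !mulmxA -[X in X *m _ = _]mulmxA WW mulmx1.
have QH : Q^t* = Q by rewrite QE trmx_mul map_mxM trmxCK.
(* The entries of D are real, being images of elements of [nu]. *)
have DR j : D 0 j = f (complex.Re (D 0 j)).
  have : D 0 j \in [seq f z | z <- nu].
    by rewrite -(perm_mem DE) map_f // mem_enum.
  by case/mapP => z _ ->.
pose c j := \sum_i ((complex.Re (W i j)) ^+ 2 + (complex.Im (W i j)) ^+ 2).
have cE j : f (c j) = Q j j.
  rewrite rmorph_sum /= QE mxE; apply: eq_bigr => i _.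
  by rewrite !mxE mulrC -normCK -add_Re2_Im2.
exists (fun j => complex.Re (D 0 j)), c; split.
- apply: (perm_map_inj (@complexI R)); rewrite -map_comp.
  by rewrite (eq_map (g := fun j => D 0 j)) // => j /=; rewrite [RHS]DR.
- move=> j; have c0 : 0 <= c j.
    by apply: sumr_ge0 => i _; rewrite addr_ge0 ?sqr_ge0.
  rewrite c0 /=; case: (ltrP 0 (c j)) => [c_gt0|]; last by move/le_trans; apply.
  rewrite -(ler_pM2l c_gt0) mulr1 -lecR.
  have Qherm l : Q l j = (Q j l)^*%R.
    by rewrite -[in LHS]QH !mxE.
  rewrite [X in _ <= X]cE -[in X in _ <= X]QQ mxE (bigD1 j) //=.
  rewrite rmorphM /= cE lerDl sumr_ge0 // => l _.
  by rewrite Qherm -normCK exprn_ge0.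
- apply: (@complexI R).
  rewrite [LHS](rmorph_sum f) rmorph_nat -[RHS](mxtrace1 _ k) -WW.
  rewrite mxtrace_mulC -QE.
  by apply: eq_bigr => j _; rewrite cE.
- apply: (@complexI R).
  rewrite -[LHS](trace_map_mx f) !map_mxM SE invmx_unitary //.
  rewrite -realf !mulmxA -WE -[_ *m P *m _]mulmxA.
  have -> : P *m (map_mx f V)^t* = W^t*.
    by rewrite WE trmx_mul map_mxM trmxCK.
  rewrite mxtrace_mulC mulmxA -QE [RHS](rmorph_sum f).
  apply: eq_bigr => j _; rewrite mul_mx_diag mxE rmorphM /= cE -DR.
  by rewrite mulrC.
Qed.

End ComplexDiagonalization.

(** The trace is a weighted sum of the eigenvalues of S whose weights lie between
0 and 1 and sum to k; no such sum exceeds the sum of the k largest ones. *)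
Lemma ky_fan_trace_le (R : rcfType) p k (S : 'M[R]_p) (V : 'M[R]_(k, p))
    (lam : k.-tuple R) :
  S^T = S -> V *m V^T = 1%:M -> largest_eigenvalues S lam ->
  \tr (V *m S *m V^T) <= \sum_(z <- lam) z.
Proof.
move=> symS orthV [mu [charS sorted_nu]].
have [d [c [dP c01 cS ->]]] := symmetric_spectral_weights symS orthV charS.
by apply: (weighted_sum_le_top sorted_nu dP c01); rewrite size_tuple.
Qed.

(** * Correctness of the Gram-Schmidt process *)

Section DotProduct.
Variables (R : rcfType) (m : nat).
Implicit Types u v w : 'cV[R]_m.

Lemma dotvC u v : dotv u v = dotv v u.
Proof. by rewrite /dotv -[in LHS](trmxK v) -trmx_mul mxE. Qed.

Lemma dotvBr u v w : dotv u (v - w) = dotv u v - dotv u w.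
Proof. by rewrite /dotv mulmxBr !mxE. Qed.

Lemma dotvZr a u v : dotv u (a *: v) = a * dotv u v.
Proof. by rewrite /dotv -scalemxAr mxE. Qed.

Lemma dotvZl a u v : dotv (a *: u) v = a * dotv u v.
Proof. by rewrite dotvC dotvZr dotvC. Qed.

Lemma dotv_sumr (I : Type) (r : seq I) (F : I -> 'cV[R]_m) u :
  dotv u (\sum_(i <- r) F i) = \sum_(i <- r) dotv u (F i).
Proof. by rewrite /dotv mulmx_sumr summxE. Qed.

Lemma dotvv_sum u : dotv u u = \sum_i u i 0 ^+ 2.
Proof. by rewrite /dotv mxE; apply: eq_bigr => i _; rewrite mxE. Qed.

Lemma dotvv_ge0 u : 0 <= dotv u u.
Proof. by rewrite dotvv_sum sumr_ge0 // => i _; rewrite sqr_ge0. Qed.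

Lemma dotvv_eq0 u : (dotv u u == 0) = (u == 0).
Proof.
apply/eqP/eqP => [|->]; last by rewrite /dotv mulmx0 mxE.
rewrite dotvv_sum => /psumr_eq0P u0; apply/colP => i; rewrite mxE.
by apply/eqP; rewrite -sqrf_eq0 u0 // => j _; rewrite sqr_ge0.
Qed.
End DotProduct.

Section GramSchmidt.
Variables (R : rcfType) (m : nat).
Implicit Types (q s : seq 'cV[R]_m) (u v : 'cV[R]_m).

(** The counterpart of [orthonormal_system] for lists, whose length may grow
along the process. *)
Definition orthonormal_seq q : Prop :=
  forall i j, (i < size q)%N -> (j < size q)%N ->
  dotv q`_i q`_j = (i == j)%:R.

Lemma orthonormal_seqP n (t : n.-tuple 'cV[R]_m) :
  orthonormal_system t <-> orthonormal_seq t.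
Proof.
split=> [ht i j|ht i j].
  rewrite size_tuple => lti ltj.
  by have := ht (Ordinal lti) (Ordinal ltj); rewrite !(tnth_nth 0).
by rewrite !(tnth_nth 0) ht ?size_tuple.
Qed.

Lemma orthonormal_seq_rcons q v :
  orthonormal_seq (rcons q v) <->
  [/\ orthonormal_seq q, forall u, u \in q -> dotv u v = 0 & dotv v v = 1].
Proof.
split=> [hqv|[hq qv vv] i j].
  split=> [i j lti ltj|u /(nthP 0)[i lti <-]|].
  - have := hqv i j; rewrite size_rcons !nth_rcons lti ltj.
    by apply; apply: ltnW.
  - have := hqv i (size q); rewrite size_rcons !nth_rcons lti ltnn eqxx.
    by rewrite (ltn_eqF lti) => ->; rewrite // ltnW.
  - have := hqv (size q) (size q); rewrite size_rcons nth_rcons ltnn !eqxx.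
    by apply.
rewrite size_rcons !ltnS !nth_rcons.
case: (ltngtP i (size q)) => [lti|//|->] _;
  case: (ltngtP j (size q)) => [ltj|//|ej] _.
- exact: hq.
- by rewrite ej qv ?mem_nth // (ltn_eqF lti).
- by rewrite dotvC qv ?mem_nth.
- by rewrite vv.
Qed.

Lemma gs_residual_orthogonal q v u :
  orthonormal_seq q -> u \in q -> dotv u (gs_residual q v) = 0.
Proof.
move=> hq /(nthP 0)[i lti <-]; rewrite /gs_residual dotvBr dotv_sumr.
rewrite (big_nth 0) big_mkord (bigD1 (Ordinal lti)) //= dotvZr hq // eqxx mulr1.
rewrite big1 ?addr0 ?subrr // => j ne_ji.
rewrite -(inj_eq val_inj) eq_sym /= in ne_ji.
by rewrite dotvZr hq // (negbTE ne_ji) mulr0.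
Qed.

(** The residual is orthogonal to [q], and normalizing it is legitimate because
only the zero vector has length zero. *)
Lemma gs_step_orthonormal q v :
  orthonormal_seq q -> orthonormal_seq (gs_step q v).
Proof.
move=> hq; rewrite /gs_step; case: eqP => // /eqP r_neq0.
set r := gs_residual q v in r_neq0 *; set a := Num.sqrt _.
have a_neq0 : a != 0.
  by rewrite sqrtr_eq0 -ltNge lt_def dotvv_eq0 r_neq0 dotvv_ge0.
apply/orthonormal_seq_rcons; split=> // [u uq|].
  by rewrite dotvZr gs_residual_orthogonal // mulr0.
rewrite dotvZl dotvZr -(sqr_sqrtr (dotvv_ge0 r)) -/a.
by rewrite mulrA -invfM -expr2 mulVf // expf_neq0.
Qed.

(** A unit vector orthogonal to [q] is its own residual, and normalizing it
divides by 1. *)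
Lemma gs_step_fixed q v :
  orthonormal_seq (rcons q v) -> gs_step q v = rcons q v.
Proof.
case/orthonormal_seq_rcons=> _ qv vv.
have res : gs_residual q v = v.
  rewrite /gs_residual big1_seq ?subr0 // => u /= uq.
  by rewrite qv // scale0r.
rewrite /gs_step res -dotvv_eq0 vv oner_eq0.
by rewrite sqrtr1 invr1 scale1r.
Qed.

Lemma foldl_gs_step_orthonormal q s :
  orthonormal_seq q -> orthonormal_seq (foldl (@gs_step R m) q s).
Proof. by elim: s q => //= v s IHs q hq; apply/IHs/gs_step_orthonormal. Qed.

Lemma gram_schmidt_fixed s : orthonormal_seq s -> gram_schmidt s = s.
Proof.
elim/last_ind: s => // s v IHs hsv; rewrite /gram_schmidt foldl_rcons.
have [hs _ _] := (orthonormal_seq_rcons s v).1 hsv.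
by rewrite -/(gram_schmidt s) IHs // gs_step_fixed.
Qed.

Lemma prefix_foldl_gs_step q s : prefix q (foldl (@gs_step R m) q s).
Proof.
elim: s q => [|v s IHs] q /=; first exact: prefix_refl.
apply: prefix_trans (IHs _).
by rewrite /gs_step; case: ifP => _; rewrite ?prefix_refl ?prefix_rcons.
Qed.

Lemma gram_schmidt_orthonormal s : orthonormal_seq (gram_schmidt s).
Proof. exact: foldl_gs_step_orthonormal. Qed.

(** The process does not alter [q] while reading it, and every later step keeps
or extends the current list. *)
Lemma gram_schmidt_extends q s :
  orthonormal_seq q -> {subset q <= gram_schmidt (q ++ s)}.
Proof.
move=> hq; rewrite /gram_schmidt foldl_cat -/(gram_schmidt q).
rewrite gram_schmidt_fixed //.
by have /prefixP[t ->] := prefix_foldl_gs_step q s => u; rewrite mem_cat => ->.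
Qed.
End GramSchmidt.

(** * Gram matrices *)

Lemma eq_col_matrix (T : Type) m n (A B : 'M[T]_(m, n)) :
  (forall j, col j A = col j B) -> A = B.
Proof.
by move=> eqAB; apply/matrixP => i j; have /colP/(_ i) := eqAB j; rewrite !mxE.
Qed.

Section GramMatrices.
Variables (R : rcfType) (m : nat).

Lemma col_cols_mx q (s : q.-tuple 'cV[R]_m) j : col j (cols_mx s) = tnth s j.
Proof. by apply/colP => i; rewrite !mxE. Qed.

Lemma gram_cols_mxE r q (B : 'M[R]_(r, m)) (s : q.-tuple 'cV[R]_m) i j :
  ((B *m cols_mx s)^T *m (B *m cols_mx s)) i j
  = dotv (B *m tnth s i) (B *m tnth s j).
Proof.
rewrite -!col_cols_mx !colE ![B *m (_ *m _)]mulmxA -!colE.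
move: (B *m _) => M.
by rewrite /dotv !mxE; apply: eq_bigr => h _; rewrite !mxE.
Qed.

Lemma orthonormal_gram_mx q (s : q.-tuple 'cV[R]_m) :
  orthonormal_system s <-> (cols_mx s)^T *m cols_mx s = 1%:M.
Proof.
have gramE i j : ((cols_mx s)^T *m cols_mx s) i j = dotv (tnth s i) (tnth s j).
  by have := gram_cols_mxE 1%:M s i j; rewrite !mul1mx.
split=> [hs|hs i j]; first by apply/matrixP => i j; rewrite gramE hs mxE.
by rewrite -gramE hs mxE.
Qed.

(** Y Y^T is the orthogonal projection onto the span of the y_j. It fixes Y
because Y (Y^T Y) = Y, and each x_i is a column of Y. *)
Lemma orthonormal_projection_fixed p k (y : p.-tuple 'cV[R]_m)
    (x : k.-tuple 'cV[R]_m) :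
  orthonormal_system y -> {subset x <= y} ->
  cols_mx y *m ((cols_mx y)^T *m cols_mx x) = cols_mx x.
Proof.
move=> /orthonormal_gram_mx hy sxy; rewrite mulmxA.
apply: eq_col_matrix => i; rewrite colE -mulmxA -colE col_cols_mx.
have /sxy/tnthP[j ->] := mem_tnth i x.
by rewrite -col_cols_mx colE -!mulmxA [_^T *m _]mulmxA hy mul1mx.
Qed.
End GramMatrices.

(** * Improvement of the trace *)

Theorem theorem2p4 (R : realType) (m n k l p : nat) (A : 'M[R]_(m, n))
    (x : k.-tuple 'cV[R]_m) (w : l.-tuple 'cV[R]_m)
    (hx : orthonormal_system x)
    (y : p.-tuple 'cV[R]_m)
    (hy : tval y = gram_schmidt (x ++ w))
    (hkp : (k < p)%N)
    (S : 'M[R]_p)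
    (hS : S = \matrix_(i, j) dotv (A^T *m tnth y i) (A^T *m tnth y j))
    (lam : k.-tuple R)
    (hlam : largest_eigenvalues S lam)
    (o : k.-tuple 'cV[R]_p)
    (ho : orthonormal_system o)
    (hSo : forall i : 'I_k, S *m tnth o i = tnth lam i *: tnth o i)
    (xt : k.-tuple 'cV[R]_m)
    (hxt : cols_mx xt = cols_mx y *m cols_mx o) :
  [/\ orthonormal_system xt,
      \sum_(i < k) dotv (A^T *m tnth x i) (A^T *m tnth x i)
        <= \sum_(i < k) dotv (A^T *m tnth xt i) (A^T *m tnth xt i)
    & forall i : 'I_k,
        tnth lam i = dotv (A^T *m tnth xt i) (A^T *m tnth xt i)].
Proof.
have orth_y : orthonormal_system y.
  by apply/orthonormal_seqP; rewrite hy; apply: gram_schmidt_orthonormal.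
have sub_xy : {subset x <= y}.
  move=> u ux; rewrite memtE hy.
  by apply: gram_schmidt_extends ux; apply/orthonormal_seqP.
have projX := orthonormal_projection_fixed orth_y sub_xy.
have gramY := (orthonormal_gram_mx y).1 orth_y.
have gramX := (orthonormal_gram_mx x).1 hx.
have gramO := (orthonormal_gram_mx o).1 ho.
have SE : S = (A^T *m cols_mx y)^T *m (A^T *m cols_mx y).
  by rewrite hS; apply/matrixP => i j; rewrite gram_cols_mxE mxE.
have symS : S^T = S by rewrite SE trmx_mul trmxK.
have lamE i : tnth lam i = dotv (A^T *m tnth xt i) (A^T *m tnth xt i).
  rewrite -gram_cols_mxE hxt [A^T *m (_ *m _)]mulmxA.
  move: (A^T *m cols_mx y) SE => G SE.
  rewrite trmx_mul -mulmxA [G^T *m _]mulmxA -SE.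
  (* The eigenvector equations S o_j = lambda_j o_j, side by side. *)
  have -> : S *m cols_mx o = cols_mx o *m diag_mx (\row_j tnth lam j).
    apply: eq_col_matrix => j; rewrite colE -mulmxA -colE col_cols_mx hSo.
    by apply/colP => h; rewrite mul_mx_diag !mxE mulrC.
  by rewrite mulmxA gramO mul1mx !mxE eqxx.
split=> //.
  apply/orthonormal_gram_mx; rewrite hxt trmx_mul -mulmxA.
  by rewrite [(cols_mx y)^T *m _]mulmxA gramY mul1mx.
pose V := (cols_mx x)^T *m cols_mx y.
have trV : V^T = (cols_mx y)^T *m cols_mx x by rewrite trmx_mul trmxK.
have orthV : V *m V^T = 1%:M by rewrite trV /V -mulmxA projX.
(* The inequality is now Ky Fan's for the compression V S V^T. *)
rewrite -(eq_bigr _ (fun i _ => lamE i)).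
have -> : \sum_(i < k) tnth lam i = \sum_(z <- lam) z by rewrite big_tuple.
have -> : \sum_(i < k) dotv (A^T *m tnth x i) (A^T *m tnth x i)
    = \tr (V *m S *m V^T).
  rewrite SE /mxtrace; apply: eq_bigr => i _; rewrite -gram_cols_mxE.
  by rewrite -[in LHS]projX -trV [A^T *m (_ *m _)]mulmxA trmx_mul trmxK !mulmxA.
exact: ky_fan_trace_le.
Qed.
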